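(* Let $X$ be a uniformly smooth (real) Banach space with modulus of smoothness $\rho(u)\le\gamma u^q$ for some $\gamma>0$ and $1<q\le2$, let $\mathcal D$ be a dictionary in $X$, and let $f\in X$ be a target element. Put $p=q/(q-1)$ and $$C(q,\gamma)=4q\,(2\gamma)^{1/q}\Big(\frac{2}{q-1}\Big)^{1/p}.$$ Take a number $\epsilon\ge0$ and an element $f^\epsilon\in X$ such that $$\|f-f^\epsilon\|\le\epsilon,\qquad f^\epsilon/A(\epsilon)\in\mathcal A_1(\mathcal D)$$ with some number $A(\epsilon)>0$. Consider an algorithm from the class $\mathcal{AWBGA}$ applied to $f$ with weakness and error parameters $\{t_m\}_{m=1}^\infty$, $\{\delta_m\}_{m=0}^\infty$, $\{\eta_m\}_{m=1}^\infty$, $\{\epsilon_m\}_{m=1}^\infty$ (and $\epsilon_0:=0$) satisfying, for every $m\ge0$ with $f_m\ne0$, $$\delta_m+\epsilon_m/\|f_m\|\le \tfrac14,\qquad \delta_m+\eta_{m+1}\le\tfrac12\,C(q,\gamma)^{-p}A(\epsilon)^{-p}\,t_{m+1}^p\,\|f_m\|^p .$$ Then for every $m\ge1$ $$\|f_m\|\le\max\Big\{4\epsilon,\;C(q,\gamma)\,(A(\epsilon)+\epsilon)\Big(1+\sum_{k=1}^m t_k^p\Big)^{-1/p}\Big\}.$$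
   Context: A dictionary in a real Banach space $X$ is a set $\mathcal D\subset X$ such that $\|g\|\le 1$ for all $g\in\mathcal D$, the closed linear span of $\mathcal D$ is $X$, and $g\in\mathcal D$ implies $-g\in\mathcal D$. $\mathcal A_1(\mathcal D)$ is the closure in $X$ of the convex hull of $\mathcal D$. For $F\in X'$, $\|F\|_{\mathcal D}:=\sup_{g\in\mathcal D}F(g)$. The modulus of smoothness is $\rho(u)=\sup_{\|x\|=\|y\|=1}\frac{\|x+uy\|+\|x-uy\|}{2}-1$; $X$ is uniformly smooth if $\lim_{u\to0}\rho(u)/u=0$. The bound $\rho(u)\le\gamma u^q$ is for all $u\ge0$. An algorithm from the class $\mathcal{AWBGA}$ (Approximate Weak Biorthogonal Greedy Algorithms) with weakness sequence $\{t_m\}_{m\ge1}\subset[0,1]$ and error parameters $\{\delta_m\}_{m\ge0},\{\eta_m\}_{m\ge1}\subset[0,1]$, $\{\epsilon_m\}_{m\ge1}\subset[0,\infty)$, applied to a target $f\in X$, produces elements $\varphi_m\in\mathcal D$ ($m\ge1$), approximants $G_m\in\operatorname{span}\{\varphi_1,\dots,\varphi_m\}$ with $G_0=0$, and remainders $f_m=f-G_m$ ($f_0=f$), for which there are functionals $F_m\in X'$ ($m\ge0$) with $\|F_m\|\le1$ and $F_m(f_m)\ge(1-\delta_m)\|f_m\|$, such that for every $m\ge1$: (1) $F_{m-1}(\varphi_m)\ge t_m\|F_{m-1}\|_{\mathcal D}$; (2) $\|f_m\|\le(1+\eta_m)\inf_{\lambda\ge0}\|f_{m-1}-\lambda\varphi_m\|$;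 (3) $|F_m(G_m)|\le\epsilon_m$. Requirements involving $F_k$ are imposed only when $f_k\ne0$. *)

(* Defs.v *)
From mathcomp Require Import all_boot all_order all_algebra.
From mathcomp Require Import all_classical all_reals all_analysis.

Set Implicit Arguments.
Unset Strict Implicit.
Unset Printing Implicit Defensive.

Import Order.TTheory GRing.Theory Num.Theory.
Import numFieldNormedType.Exports.

Local Open Scope classical_set_scope.
Local Open Scope ring_scope.

Definition lin_span (R : realType) (X : lmodType R) (S : set X) : set X :=
  [set x | exists n (c : 'I_n -> R) (g : 'I_n -> X),
             (forall i, S (g i)) /\ x = \sum_(i < n) c i *: g i].

Definition convex_hull (R : realType) (X : lmodType R) (S : set X) : set X :=
  smallest (fun C : set X => convex_set (C : set (convex_lmodType X))) S.

Definition dictionary (R : realType) (X : normedModType R) (D : set X) : Prop :=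
  [/\ forall g, D g -> `|g| <= 1,
      closure (lin_span D) = setT
    & forall g, D g -> D (- g)].

Definition A1 (R : realType) (X : normedModType R) (D : set X) : set X :=
  closure (convex_hull D).

(* Elements of the dual are linear maps [F : {linear X -> R^o}] together with
   [continuous F]; continuity is what makes the two real suprema below suprema
   of bounded sets. *)
Definition dual_norm (R : realType) (X : normedModType R)
    (F : {linear X -> R^o}) : R :=
  sup [set `|F x| | x in [set x : X | `|x| <= 1]].

Definition dict_norm (R : realType) (X : normedModType R) (D : set X)
    (F : {linear X -> R^o}) : R :=
  sup [set (F g : R) | g in D].

Definition mod_smooth (R : realType) (X : normedModType R) (u : R) : R :=
  sup [set r | exists x y : X, [/\ `|x| = 1, `|y| = 1 &
         r = (`|x + u *: y| + `|x - u *: y|) / 2 - 1]].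

Definition uniformly_smooth (R : realType) (X : normedModType R) : Prop :=
  mod_smooth X u / u @[u --> 0^'] --> (0 : R).

(* [t], [eta], [eps] and [phi] are meaningful from index 1 on; their values at
   index 0 are not constrained here. *)
Definition AWBGA_params (R : realType) (t delta eta eps : nat -> R) : Prop :=
  [/\ forall m, (1 <= m)%N -> 0 <= t m <= 1,
      forall m, 0 <= delta m <= 1,
      forall m, (1 <= m)%N -> 0 <= eta m <= 1
    & forall m, (1 <= m)%N -> 0 <= eps m].

Record AWBGA_with (R : realType) (X : normedModType R) (D : set X) (f : X)
    (t delta eta eps : nat -> R) (phi G : nat -> X)
    (F : nat -> {linear X -> R^o}) : Prop := {
  awbga_phi : forall m, (1 <= m)%N -> D (phi m);
  awbga_G0 : G 0%N = 0;
  awbga_G : forall m, (1 <= m)%N ->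
    lin_span [set phi k | k in [set k | (1 <= k <= m)%N]] (G m);
  awbga_F : forall m, f - G m != 0 ->
    [/\ continuous (F m), dual_norm (F m) <= 1
      & (1 - delta m) * `|f - G m| <= F m (f - G m)];
  awbga_greedy : forall m, (1 <= m)%N -> f - G m.-1 != 0 ->
    t m * dict_norm D (F m.-1) <= F m.-1 (phi m);
  awbga_reduction : forall m, (1 <= m)%N ->
    `|f - G m| <= (1 + eta m) *
      inf [set `|f - G m.-1 - l *: phi m| | l in [set l : R | 0 <= l]];
  awbga_biorth : forall m, (1 <= m)%N -> f - G m != 0 ->
    `|F m (G m)| <= eps m
}.

(* [phi] and [G] are the dictionary elements and approximants produced by some
   run, on the target [f], of an algorithm of the class. *)
Definition AWBGA (R : realType) (X : normedModType R) (D : set X) (f : X)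
    (t delta eta eps : nat -> R) (phi G : nat -> X) : Prop :=
  AWBGA_params t delta eta eps /\
  exists F : nat -> {linear X -> R^o}, AWBGA_with D f t delta eta eps phi G F.

Definition conj_exp (R : realType) (q : R) : R := q / (q - 1).

Definition Cqg (R : realType) (q gamma : R) : R :=
  4 * q * (2 * gamma) `^ (q^-1) * (2 / (q - 1)) `^ ((conj_exp q)^-1).

(* Main.v *)
(* Write [r = |f_m|] and [w = (t_{m+1} r / (C A))^p].  Testing [F_m] on [fe]
   shows that its dictionary norm is at least [r / (4 A)] as soon as
   [2 e <= r]; the modulus of smoothness then bounds [|f_m - l phi_{m+1}|], and
   optimizing over [l] gives a relative decrease of [2 w], of which the errors
   [delta] and [eta] consume at most half: [|f_{m+1}| <= r (1 - w)].  When
   [r < 2 e], the crude factor [1 + eta <= 2] keeps [|f_{m+1}| <= 4 e].  Hence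
   the residual, once below [4 e], stays there, and before that
   [(C (A + e) / r)^p] increases by at least [t_{m+1}^p] at each step.  It is at
   least [1] at the start because [C >= 1], a consequence of [rho 2 >= 1]. *)
Require Import Defs.
From mathcomp Require Import all_boot all_order all_algebra.
From mathcomp Require Import all_classical all_reals all_analysis.
From mathcomp Require Import ring lra.

Set Implicit Arguments.
Unset Strict Implicit.
Unset Printing Implicit Defensive.

Import Order.TTheory GRing.Theory Num.Theory.
Import numFieldNormedType.Exports.

Local Open Scope classical_set_scope.
Local Open Scope ring_scope.

(** * Bounds on the closed convex hull, dual norm and dictionary norm *)

Lemma A1_sub (R : realType) (X : normedModType R) (D C : set X) :
  convex_set (C : set (convex_lmodType X)) -> closed C -> D `<=` C ->
  A1 D `<=` C.
Proof.
move=> Ccvx Ccl DC; rewrite (closure_id C).1//; apply: closureS.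
exact: smallest_sub.
Qed.

Lemma convex_setZ (R : realType) (X : lmodType R) (C : set X) :
  (forall (x y : X) (l : R), 0 <= l -> l <= 1 -> C x -> C y ->
     C (l *: x + (1 - l) *: y)) ->
  convex_set (C : set (convex_lmodType X)).
Proof.
move=> CP x y l; rewrite !inE => Cx Cy.
exact: (CP x y l%:num (ge0 _) (le1 _) Cx Cy).
Qed.

Lemma A1_norm_le1 (R : realType) (X : normedModType R) (D : set X) (x : X) :
  (forall g, D g -> `|g| <= 1) -> A1 D x -> `|x| <= 1.
Proof.
move=> D1; apply: (@A1_sub _ _ D [set x : X | `|x| <= 1]) => //.
- apply: convex_setZ => y z l l0 l1 /= y1 z1.
  rewrite (le_trans (ler_normD _ _))// !normrZ !ger0_norm ?subr_ge0//.
  have : l * `|y| <= l by rewrite ler_piMr.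
  have : (1 - l) * `|z| <= 1 - l by rewrite ler_piMr// subr_ge0.
  lra.
- apply: (@preimage_closed _ _ (fun x : X => `|x|) [set r | r <= 1]).
    by move=> y _; exact: norm_continuous.
  exact: closed_le.
Qed.

Lemma A1_linear_le (R : realType) (X : normedModType R) (D : set X)
    (F : {linear X -> R^o}) (c : R) (x : X) :
  continuous F -> (forall g, D g -> F g <= c) -> A1 D x -> F x <= c.
Proof.
move=> Fc Dc; apply: (@A1_sub _ _ D [set x : X | F x <= c]) => //.
- apply: convex_setZ => y z l l0 l1 /= yc zc.
  rewrite linearD !linearZ/= /GRing.scale/=.
  have : l * F y <= l * c by rewrite ler_wpM2l.
  have : (1 - l) * F z <= (1 - l) * c by rewrite ler_wpM2l// subr_ge0.
  lra.
- apply: (@preimage_closed _ _ (fun x : X => F x : R) [set r | r <= c]).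
    by move=> y _; exact: Fc.
  exact: closed_le.
Qed.

(** Continuity bounds [F] on the unit ball, so the [sup] is a genuine one and not the default value
    0; homogeneity does the rest. *)
Lemma le_dual_norm (R : realType) (X : normedModType R)
    (F : {linear X -> R^o}) (x : X) :
  continuous F -> `|F x| <= dual_norm F * `|x|.
Proof.
move=> /linear_bounded_continuous /bounded_funP /(_ 1)[M FM].
have [->|x0] := eqVneq x 0; first by rewrite linear0 !normr0 mulr0.
have nx0 : 0 < `|x| by rewrite normr_gt0.
rewrite -ler_pdivrMr// mulrC.
have -> : `|x|^-1 * `|F x| = `|F (`|x|^-1 *: x)|.
  by rewrite linearZ/= normrZ ger0_norm.
apply: ub_le_sup.
  by exists M => _ [y y1 <-]; exact: FM.
exists (`|x|^-1 *: x) => //=.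
by rewrite normrZ ger0_norm ?invr_ge0// mulVf ?normr_eq0.
Qed.

Lemma le_dict_norm (R : realType) (X : normedModType R) (D : set X)
    (F : {linear X -> R^o}) (g : X) :
  (forall h, D h -> `|h| <= 1) -> continuous F -> D g ->
  F g <= dict_norm D F.
Proof.
move=> D1 Fc Dg; apply: ub_le_sup; last by exists g.
exists (dual_norm F) => _ [h Dh <-].
apply: (le_trans (ler_norm _)); apply: (le_trans (le_dual_norm _ Fc)).
rewrite ler_piMr ?D1//; apply: ub_le_sup.
  move: Fc => /linear_bounded_continuous /bounded_funP /(_ 1)[M FM].
  by exists M => _ [y y1 <-]; exact: FM.
by exists 0; rewrite /= ?linear0 normr0.
Qed.

(** The triangle inequality bounds the set by [u], which makes its [sup] an upper bound. *)
Lemma le_mod_smooth (R : realType) (X : normedModType R) (u : R) (x y : X) :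
  0 <= u -> `|x| = 1 -> `|y| = 1 ->
  (`|x + u *: y| + `|x - u *: y|) / 2 - 1 <= mod_smooth X u.
Proof.
move=> u0 x1 y1; apply: ub_le_sup; last by exists x, y.
exists u => _ [x' [y' [x'1 y'1 ->]]].
have := ler_normD x' (u *: y'); have := ler_normB x' (u *: y').
rewrite normrZ x'1 y'1 mulr1 ger0_norm// => ha hb.
by rewrite lerBlDr ler_pdivrMr//; lra.
Qed.

(** * Consequences of the power bound on the modulus of smoothness *)

Section PowerModulus.
Variables (R : realType) (X : normedModType R) (gamma q : R).
Hypotheses (gamma_gt0 : 0 < gamma) (q_gt1 : 1 < q).
Hypothesis X_modulus :
  forall u : R, 0 <= u -> mod_smooth X u <= gamma * u `^ q.

Lemma normB_add_normD_le (x y : X) (l : R) :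
  x != 0 -> `|y| <= 1 -> 0 <= l ->
  `|x - l *: y| + `|x + l *: y| <= 2 * `|x| * (1 + gamma * (l / `|x|) `^ q).
Proof.
move=> x0 y1 l0.
have nx0 : 0 < `|x| by rewrite normr_gt0.
have lx0 : 0 <= l / `|x| by rewrite divr_ge0.
have Q0 : 0 <= gamma * (l / `|x|) `^ q by rewrite mulr_ge0 ?powR_ge0// ltW.
have [->|y0] := eqVneq y 0.
  rewrite scaler0 subr0 addr0.
  by have := mulr_ge0 (ltW nx0) Q0; lra.
have ny0 : 0 < `|y| by rewrite normr_gt0.
(* Chosen so that [u] times the unit vector along [y] is [l *: y] divided by the norm of [x]. *)
pose u := l / `|x| * `|y|.
have u0 : 0 <= u by rewrite mulr_ge0// ltW.
have unit_norm (z : X) : z != 0 -> `| `|z|^-1 *: z| = 1.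
  by move=> z0; rewrite normrZ ger0_norm ?invr_ge0// mulVf ?normr_eq0.
have := le_trans (le_mod_smooth u0 (unit_norm _ x0) (unit_norm _ y0))
  (X_modulus u0).
have uy : u *: (`|y|^-1 *: y) = `|x|^-1 *: (l *: y).
  rewrite !scalerA; congr (_ *: _); rewrite /u -mulrA mulfV ?gt_eqF//.
  by rewrite mulr1 mulrC.
rewrite uy -scalerDr -scalerBr !normrZ ger0_norm ?invr_ge0//.
have : u `^ q <= (l / `|x|) `^ q.
  apply: ge0_ler_powR; rewrite ?nnegrE ?(ltW (lt_trans _ q_gt1))//.
  by rewrite ler_piMr.
set a := `|x + l *: y|; set b := `|x - l *: y|.
set P := u `^ q; set Q := (l / _) `^ q.
move=> PQ H.
have {}H : (a + b) / `|x| <= 2 * (1 + gamma * Q).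
  have : gamma * P <= gamma * Q by rewrite ler_pM2l.
  move: H; rewrite mulrDl !(mulrC _^-1); lra.
by rewrite addrC mulrAC -ler_pdivrMr.
Qed.

(** As [F] nearly norms [x], the norm of [x + l *: y] is at least [(1 - d) * |x| + l * F y];
    subtract this from the bound on the sum of the two norms. *)
Lemma norm_sub_scale_le (F : {linear X -> R^o}) (x y : X) (d l : R) :
  continuous F -> dual_norm F <= 1 -> (1 - d) * `|x| <= F x ->
  x != 0 -> `|y| <= 1 -> 0 <= l ->
  `|x - l *: y| <=
    `|x| * (1 + d + 2 * gamma * (l / `|x|) `^ q) - l * F y.
Proof.
move=> Fc F1 Fx x0 y1 l0.
have := normB_add_normD_le x0 y1 l0.
have : F x + l * F y <= `|x + l *: y|.
  have -> : F x + l * F y = F (x + l *: y) by rewrite linearD linearZ.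
  apply: le_trans (ler_norm _) _; apply: le_trans (le_dual_norm _ Fc) _.
  by rewrite ler_piMl.
set Q := _ `^ _; nra.
Qed.

(* [rho 2 >= 1] in every nonzero space, by taking both unit vectors equal. *)
Lemma power_modulus_ge (x : X) : x != 0 -> 1 <= gamma * 2 `^ q.
Proof.
move=> x0; have two0 : 0 <= 2 :> R by [].
have e1 : `| `|x|^-1 *: x| = 1.
  by rewrite normrZ ger0_norm ?invr_ge0// mulVf ?normr_eq0.
apply: le_trans (X_modulus two0); apply: le_trans (le_mod_smooth two0 e1 e1).
set z := `|x|^-1 *: x in e1 *.
have -> : z + 2 *: z = 3 *: z by rewrite -[X in X + _]scale1r -scalerDl.
have -> : z - 2 *: z = - z.
  by rewrite scaler_nat mulr2n opprD addrA subrr add0r.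
by rewrite normrN normrZ e1 ger0_norm//; lra.
Qed.
End PowerModulus.

Lemma powRV (R : realType) (x y : R) : 0 <= x -> x^-1 `^ y = (x `^ y)^-1.
Proof. by move=> x0; rewrite -powR_inv1// powRAC powR_inv1 ?powR_ge0. Qed.

(** * The constant [Cqg] and the optimal step length *)

Section RealInequalities.
Variables (R : realType) (gamma q : R).
Hypotheses (gamma_gt0 : 0 < gamma) (q_gt1 : 1 < q).
Let p := conj_exp q.
Let qB1_neq0 : q - 1 != 0.
Proof. by rewrite subr_eq0 gt_eqF. Qed.
Let q_gt0 : 0 < q.
Proof. exact: lt_trans q_gt1. Qed.
Let q_neq0 : q != 0.
Proof. by rewrite gt_eqF. Qed.

Lemma conj_expE : p = 1 + (q - 1)^-1.
Proof. by rewrite /p /conj_exp; field. Qed.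

Lemma conj_exp_gt1 : 1 < p.
Proof. by rewrite conj_expE ltrDl invr_gt0 subr_gt0. Qed.

Lemma Cqg_gt0 : 0 < Cqg q gamma.
Proof.
rewrite /Cqg !mulr_gt0 ?powR_gt0 ?mulr_gt0 ?invr_gt0 ?subr_gt0//.
Qed.

(** Since [p / q = 1 / (q - 1)], the [p]-th power clears the exponents [1 / q] and [1 / p]. *)
Lemma Cqg_powR :
  Cqg q gamma `^ p =
    4 `^ p * q `^ p * (2 * gamma) `^ (q - 1)^-1 * (2 / (q - 1)).
Proof.
have p0 : p != 0 by rewrite gt_eqF// (lt_trans _ conj_exp_gt1).
have E : q^-1 * p = (q - 1)^-1.
  by rewrite /p /conj_exp; field; rewrite q_neq0 qB1_neq0.
have : 0 <= 2 / (q - 1) by rewrite divr_ge0// subr_ge0 ltW.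
have : 0 <= 2 * gamma by rewrite mulr_ge0// ltW.
rewrite /Cqg -/p; move: (2 * gamma) (2 / (q - 1)) => u v u0 v0.
rewrite !(powRM, mulr_ge0, powR_ge0) ?(ltW q_gt0)//.
by rewrite -!powRrM E mulVf// powRr1.
Qed.

(* The constant [Cqg] is the one for which the maximum over [mu >= 0] of
   [mu * a - 2 * gamma * mu `^ q] is exactly [2 * (4 * a / Cqg) `^ p]. *)
Lemma power_gain (a : R) : 0 <= a -> exists2 mu : R, 0 <= mu &
  mu * a - 2 * gamma * mu `^ q = 2 * (4 * a / Cqg q gamma) `^ p.
Proof.
(* The critical point, where [a = 2 * gamma * q * mu^(q - 1)]. *)
move=> a0; pose k := (q - 1)^-1; exists ((a / (2 * gamma * q)) `^ k).
  exact: powR_ge0.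
have k0 : 0 < k by rewrite invr_gt0 subr_gt0.
have C0 := Cqg_gt0.
have gq0 : 0 < 2 * gamma * q by rewrite !mulr_gt0.
rewrite -powRrM (_ : k * q = p); last by rewrite /p /conj_exp mulrC.
rewrite (powRM _ (mulr_ge0 _ a0)) ?invr_ge0 ?(ltW C0)//.
rewrite (powRV _ (ltW C0)) Cqg_powR.
rewrite (powRM p _ a0)//.
(* As [p = 1 + k], only [k]-th powers remain; they become atoms for [field]. *)
have E (b : R) : 0 <= b -> b `^ p = b * b `^ k.
  move=> b0; rewrite conj_expE powRD ?powRr1//.
  by apply/implyP; rewrite gt_eqF// addr_gt0.
rewrite (E _ (divr_ge0 a0 (ltW gq0))) (E a a0) (E q (ltW q_gt0)).
rewrite (E 4 (ler0n _ _)).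
rewrite (powRM k a0) ?invr_ge0 ?(ltW gq0)//.
rewrite (powRV _ (ltW gq0)).
rewrite (powRM k _ (ltW q_gt0)) ?mulr_ge0 ?ltW//.
rewrite -/k.
have : (2 * gamma) `^ k != 0 by rewrite gt_eqF ?powR_gt0 ?mulr_gt0.
have : q `^ k != 0 by rewrite gt_eqF ?powR_gt0.
have : 4 `^ k != 0 :> R by rewrite gt_eqF ?powR_gt0.
move: (a `^ k) (_ `^ k) (_ `^ k) (_ `^ k) => ak gk qk fk; rewrite /k => *.
by field; rewrite ?(gt_eqF gamma_gt0); do ?[apply/andP; split].
Qed.

(** The second hypothesis gives [2 * gamma >= 2^(-q)], hence a factor at least 1/2; [q <= 2] makes
    the last factor at least 1, and [4 * q] absorbs the 1/2. *)
Lemma Cqg_ge1 : q <= 2 -> 1 <= gamma * 2 `^ q -> 1 <= Cqg q gamma.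
Proof.
move=> q2 gq.
have h1 : 2^-1 <= (2 * gamma) `^ q^-1.
  have -> : 2^-1 = ((2 `^ q)^-1) `^ q^-1 :> R.
    rewrite -powRN -powRrM mulNr divff//.
    by rewrite powR_inv1.
  apply: ge0_ler_powR; rewrite ?nnegrE ?invr_ge0 ?powR_ge0 ?mulr_ge0
    ?(ltW gamma_gt0) ?(ltW q_gt0)//.
  have P0 : 0 < 2 `^ q :> R by rewrite powR_gt0.
  by rewrite -[leLHS]mul1r ler_pdivrMr//; nra.
have h2 : 1 <= (2 / (q - 1)) `^ p^-1.
  apply: (@le_trans _ _ (1 `^ p^-1)); first by rewrite powR1.
  apply: ge0_ler_powR; rewrite ?nnegrE//.
  - by rewrite invr_ge0 (le_trans ler01 (ltW conj_exp_gt1)).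
  - by rewrite divr_ge0// subr_ge0 ltW.
  - by rewrite ler_pdivlMr ?subr_gt0// mul1r lerBlDr; lra.
rewrite /Cqg -/p; move: (_ `^ q^-1) (_ `^ p^-1) h1 h2 => u v h1 h2.
have h3 : 2^-1 <= q * u by rewrite -[leLHS]mul1r ler_pM// ltW.
by have := ler_pM _ _ h3 h2; lra.
Qed.
End RealInequalities.

(* In terms of [x = (r / B) `^ p] the recursion gives
   [x' <= x * (1 - s * x) <= x / (1 + s * x)], that is [1 / x' >= 1 / x + s]. *)
Lemma power_recursion_step (R : realType) (p B S s r r' : R) :
  1 <= p -> 0 < B -> 1 <= S -> 0 <= s -> 0 < r -> 0 <= r' ->
  r' <= r * (1 - s * (r / B) `^ p) ->
  r <= B * S `^ (- p^-1) -> r' <= B * (S + s) `^ (- p^-1).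
Proof.
move=> p1 B0 S1 s0 r0 r'0 rec.
have p0 : 0 < p by lra.
have pN0 : p != 0 by rewrite gt_eqF.
have S0 : 0 < S by lra.
have Ss0 : 0 < S + s by lra.
rewrite -!ler_pdivrMl// ![B^-1 * _]mulrC => rS.
have rBp0 : 0 <= r / B by rewrite divr_ge0// ltW.
have rB'0 : 0 <= r' / B by rewrite divr_ge0// ltW.
pose x := (r / B) `^ p.
have x0 : 0 < x by rewrite powR_gt0// divr_gt0.
have pK (T : R) : 0 < T -> (T `^ (- p^-1)) `^ p = T^-1.
  by move=> T0; rewrite -powRrM mulNr mulVf// powR_inv1// ltW.
have xS : x <= S^-1.
  by rewrite -pK//; apply: ge0_ler_powR; rewrite ?nnegrE ?powR_ge0// ltW.
have pL (T : R) : 0 < T -> T `^ (- p^-1) = T^-1 `^ p^-1.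
  by move=> T0; rewrite -mulN1r powRrM powR_inv1// ltW.
have main : (r' / B) `^ p <= (S + s)^-1.
  (* The sign comes from [0 <= r']; nothing bounds [s * x] directly. *)
  have c0 : 0 <= 1 - s * x by rewrite -(pmulr_rge0 _ r0); exact: le_trans rec.
  have : (r' / B) `^ p <= x * (1 - s * x).
    apply: (@le_trans _ _ ((r / B * (1 - s * x)) `^ p)).
      apply: ge0_ler_powR; rewrite ?nnegrE ?(ltW p0)//.
        by rewrite mulr_ge0.
      by rewrite mulrAC ler_pM2r ?invr_gt0.
    rewrite powRM// ler_pM2l//.
    have [->|c1] := eqVneq (1 - s * x) 0; first by rewrite powR0.
    by apply: ge1r_powR => //; rewrite lt0r c1 c0/=; nra.
  move=> /le_trans; apply.
  (* With [x * S <= 1], the product is at most [(1 - s * x) * (1 + s * x) <= 1]. *)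
  rewrite -[leRHS]mul1r ler_pdivlMr//.
  have xS1 : x * S <= 1 by rewrite -ler_pdivlMr// mul1r.
  by have := mulr_ge0 s0 (ltW x0); nra.
rewrite pL//.
have -> : r' / B = ((r' / B) `^ p) `^ p^-1 by rewrite -powRrM divff// powRr1.
by apply: ge0_ler_powR; rewrite ?nnegrE ?powR_ge0 ?invr_ge0 ?(ltW p0)
  ?(ltW Ss0).
Qed.

(** * Decay of the residuals *)

Section Residuals.
Variables (R : realType) (X : normedModType R) (gamma q : R).
Hypotheses (gamma_gt0 : 0 < gamma) (q_gt1 : 1 < q).
Hypothesis X_modulus :
  forall u : R, 0 <= u -> mod_smooth X u <= gamma * u `^ q.
Variables (D : set X) (f fe : X) (e A : R).
Hypotheses (D1 : forall g, D g -> `|g| <= 1) (A_gt0 : 0 < A).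
Hypotheses (f_fe : `|f - fe| <= e) (fe_A1 : A1 D (A^-1 *: fe)).

(** With [r = |f - g|], writing [fe = (f - g) + g - (f - fe)] gives [F fe >= (1 - d) * r - ep - e >=
    3r/4 - r/2], while [F fe] is at most [A] times the dictionary norm. *)
Lemma dict_norm_ge (F : {linear X -> R^o}) (g : X) (d ep : R) :
  continuous F -> dual_norm F <= 1 -> (1 - d) * `|f - g| <= F (f - g) ->
  `|F g| <= ep -> f - g != 0 -> d + ep / `|f - g| <= 4^-1 ->
  2 * e <= `|f - g| -> `|f - g| / (4 * A) <= dict_norm D F.
Proof.
move=> Fc F1 Ff Fg fg0 dep er; set r := `|f - g| in Ff dep er *.
have r0 : 0 < r by rewrite normr_gt0.
have Fe : F (f - fe) <= e.
  apply: le_trans (ler_norm _) _; apply: le_trans (le_dual_norm _ Fc) _.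
  by apply: le_trans f_fe; rewrite ler_piMl.
have Ffe : F fe <= dict_norm D F * A.
  have /(A1_linear_le Fc) := fe_A1 => /(_ (dict_norm D F)).
  rewrite linearZ/= /GRing.scale/= mulrC ler_pdivrMr//; apply => h Dh.
  exact: le_dict_norm.
have {}dep : d * r + ep <= r / 4.
  have := dep; rewrite -(ler_pM2r r0) mulrDl divfK ?gt_eqF//.
  by rewrite (mulrC 4^-1).
rewrite invfM mulrA ler_pdivrMr//; apply: le_trans Ffe.
move: Ff Fe; rewrite !linearB/= => Ff Fe.
have := ler_norm (- F g); rewrite normrN => Fg'.
by move: r r0 er dep Ff => r r0 er dep Ff; lra.
Qed.

Variables (t delta eta eps : nat -> R) (phi G : nat -> X).
Variable F : nat -> {linear X -> R^o}.
Hypothesis alg_params : AWBGA_params t delta eta eps.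
Hypothesis alg : AWBGA_with D f t delta eta eps phi G F.
Hypothesis eps0 : eps 0%N = 0.
Let C := Cqg q gamma.
Let p := conj_exp q.
Hypothesis h_delta_eps : forall m : nat, f - G m != 0 ->
  delta m + eps m / `|f - G m| <= 4^-1.
Hypothesis h_delta_eta : forall m : nat, f - G m != 0 ->
  delta m + eta m.+1 <=
    2^-1 * C `^ (- p) * A `^ (- p) * t m.+1 `^ p * `|f - G m| `^ p.

Lemma residual_le (m : nat) (l : R) : 0 <= l ->
  `|f - G m.+1| <= (1 + eta m.+1) * `|f - G m - l *: phi m.+1|.
Proof.
move=> l0; have [_ _ eta01 _] := alg_params.
apply: le_trans (awbga_reduction alg (ltn0Sn m)) _.
have /andP[eta_ge0 _] := eta01 m.+1 (ltn0Sn m).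
rewrite ler_wpM2l ?addr_ge0//; apply: ge_inf; last by exists l.
by exists 0 => _ [k _ <-].
Qed.

Lemma residual_step (m : nat) :
  f - G m != 0 -> 2 * e <= `|f - G m| ->
  `|f - G m.+1| <=
    `|f - G m| * (1 - (t m.+1 * `|f - G m| / (C * A)) `^ p).
Proof.
move=> fm0 er; have [t01 d01 eta01 eps_ge0] := alg_params.
have r0 : 0 < `|f - G m| by rewrite normr_gt0.
have /andP[t_ge0 _] := t01 m.+1 (ltn0Sn m).
have /andP[eta_ge0 eta_le1] := eta01 m.+1 (ltn0Sn m).
have /andP[d_ge0 _] := d01 m.
have [Fc F1 Ff] := awbga_F alg fm0.
have C0 : 0 < C := Cqg_gt0 gamma_gt0 q_gt1.
have FG : `|F m (G m)| <= eps m.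
  (* Biorthogonality is imposed from index 1 on; at 0 both sides vanish. *)
  case: (m) fm0 => [|k] fk0; last exact: (awbga_biorth alg).
  by rewrite (awbga_G0 alg) linear0 normr0 eps0.
have dn := dict_norm_ge Fc F1 Ff FG fm0 (h_delta_eps fm0) er.
pose a := t m.+1 * (`|f - G m| / (4 * A)).
have a0 : 0 <= a by rewrite mulr_ge0// divr_ge0// mulr_ge0// ltW.
have Fphi : a <= F m (phi m.+1).
  apply: le_trans (awbga_greedy alg (ltn0Sn m) fm0).
  by rewrite ler_wpM2l.
have [mu mu0 gain] := power_gain gamma_gt0 q_gt1 a0.
(* The step length is scaled by the residual, as the smoothness bound depends on [l / |f_m|]. *)
have l0 : 0 <= `|f - G m| * mu by rewrite mulr_ge0.
have phi1 := D1 (awbga_phi alg (ltn0Sn m)).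
have := norm_sub_scale_le gamma_gt0 q_gt1 X_modulus Fc F1 Ff fm0 phi1 l0.
have := residual_le m l0.
have := h_delta_eta fm0.
have wE : 4 * a / C = t m.+1 * `|f - G m| / (C * A).
  by rewrite /a; field; rewrite !gt_eqF.
rewrite -/p -/C wE in gain.
have -> : 2^-1 * C `^ (- p) * A `^ (- p) * t m.+1 `^ p * `|f - G m| `^ p
          = (t m.+1 * `|f - G m| / (C * A)) `^ p / 2.
  move: (C) C0 => c c0; have cA0 : 0 <= c * A by rewrite mulr_ge0 ?ltW.
  rewrite !powRN !powRM ?mulr_ge0 ?invr_ge0// powRV// powRM ?ltW// invfM.
  by ring.
rewrite (mulrC _ mu) mulfK ?gt_eqF//.
have : 0 <= (t m.+1 * `|f - G m| / (C * A)) `^ p by exact: powR_ge0.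
move: gain Fphi; move: (_ `^ p) (mu `^ q) (delta m) (eta m.+1) r0 mu0 a0
  d_ge0 eta_ge0 eta_le1.
move: (F m (phi m.+1)) `|f - G m| `|f - G m.+1| `|_ - _ *: _| (a) {wE}.
move=> Fp r r' s b w muq d et r0 mu0 a0 d0 et0 et1 gain Fp_ge w0 det r's sr.
apply: (le_trans r's).
have : s <= r * (1 + d - 2 * w).
  apply: (le_trans sr); have : mu * r * b <= mu * r * Fp.
    by rewrite ler_wpM2l// mulr_ge0// ltW.
  have : r * (mu * b - 2 * gamma * muq) = r * (2 * w).
    by rewrite gain.
  lra.
move=> sw; apply: (@le_trans _ _ ((1 + et) * (r * (1 + d - 2 * w)))).
  by rewrite ler_wpM2l// addr_ge0.
(* As [et <= 1], [(1 + et) * (1 + d - 2 * w) <= 1 + 2 * d + et - 2 * w], and [d + et <= w / 2]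
   brings this below [1 - w]. *)
rewrite mulrCA ler_pM2l//; have := mulr_ge0 et0 w0.
have : et * d <= d by rewrite ler_piMl.
lra.
Qed.

Hypothesis q_le2 : q <= 2.

Lemma residual_bound (m : nat) :
  `|f - G m| <=
    Num.max (4 * e)
      (C * (A + e) * (1 + \sum_(1 <= k < m.+1) t k `^ p) `^ (- p^-1)).
Proof.
have [t01 _ eta01 _] := alg_params.
have e0 : 0 <= e by exact: le_trans f_fe.
have C0 : 0 < C := Cqg_gt0 gamma_gt0 q_gt1.
have p1 : 1 < p := conj_exp_gt1 q_gt1.
have p0 : 0 <= p by rewrite ltW// (lt_trans ltr01).
have CA0 : 0 < C * A by exact: mulr_gt0.
have B0 : 0 < C * (A + e) by rewrite mulr_gt0// ltr_wpDr.
elim: m => [|m IH].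
  rewrite big_nil addr0 powR1 mulr1 (awbga_G0 alg) subr0 le_max; apply/orP.
  have [->|f0] := eqVneq f 0; first by left; rewrite normr0 mulr_ge0.
  right; have C1 : 1 <= C.
    exact: Cqg_ge1 gamma_gt0 q_gt1 q_le2 (power_modulus_ge X_modulus f0).
  have feA : `|fe| <= A.
    have := A1_norm_le1 D1 fe_A1.
    rewrite normrZ ger0_norm ?invr_ge0 ?(ltW A_gt0)//.
    by rewrite mulrC ler_pdivrMr// mul1r.
  apply: (@le_trans _ _ (A + e)); last by rewrite ler_peMl// addr_ge0// ltW.
  by rewrite -[f](subrK fe) addrC (le_trans (ler_normD _ _))// lerD.
have /andP[eta_ge0 eta_le1] := eta01 m.+1 (ltn0Sn m).
(* Uses only the competitor [l = 0] and no functional, so it also covers a zero residual. *)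
have small : `|f - G m| <= 2 * e -> `|f - G m.+1| <= 4 * e.
  move=> r2; apply: le_trans (residual_le m (lexx 0)) _.
  rewrite scale0r subr0.
  apply: (@le_trans _ _ (2 * (2 * e))); last by lra.
  by apply: ler_pM => //; lra.
rewrite le_max; apply/orP.
have [fm0|fm0] := eqVneq (f - G m) 0.
  by left; apply: small; rewrite fm0 normr0 mulr_ge0.
have r0 : 0 < `|f - G m| by rewrite normr_gt0.
have [/small|/ltW er] := leP `|f - G m| (2 * e); first by left.
have step := residual_step fm0 er.
(* Between [2 * e] and [4 * e] the residual does not increase, which suffices. *)
have [r4|r4] := leP `|f - G m| (4 * e).
  left; apply: le_trans step (le_trans _ r4).
  by rewrite ler_piMr// lerBlDr lerDl powR_ge0.
right; rewrite big_nat_recr//= addrA.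
have /andP[t_ge0 _] := t01 m.+1 (ltn0Sn m).
apply: (power_recursion_step (ltW p1) B0 _ _ r0) => //.
- by rewrite lerDl sumr_ge0// => k _; exact: powR_ge0.
- exact: powR_ge0.
(* Replacing [A] by [A + e] weakens the decrease but matches the constant [B] of the recursion,
   which the initial bound on [|f|] dictates. *)
- apply: le_trans step _; rewrite ler_pM2l// lerD2l lerN2 -powRM//; last first.
    by rewrite divr_ge0// ltW.
  apply: ge0_ler_powR => //; rewrite ?nnegrE.
  + by rewrite mulr_ge0// divr_ge0// ltW.
  + by rewrite divr_ge0// mulr_ge0// ltW.
  + rewrite -mulrA ler_wpM2l// ler_pM2l// lef_pV2 ?posrE//.
    by rewrite ler_pM2l// lerDl.
(* Above [4 * e] the induction hypothesis can only hold through its second term. *)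
- by move: IH; rewrite le_max => /orP[|//]; rewrite leNgt r4.
Qed.
End Residuals.

Theorem theorem8p2 (R : realType) (X : completeNormedModType R)
  (gamma q : R) (gamma_gt0 : 0 < gamma) (q_gt1 : 1 < q) (q_le2 : q <= 2)
  (X_smooth : uniformly_smooth X)
  (X_modulus : forall u : R, 0 <= u -> mod_smooth X u <= gamma * u `^ q)
  (D : set X) (D_dict : dictionary D) (f : X)
  (e : R) (e_ge0 : 0 <= e) (fe : X) (A : R) (A_gt0 : 0 < A)
  (f_fe : `|f - fe| <= e) (fe_A1 : A1 D (A^-1 *: fe))
  (t delta eta eps : nat -> R) (phi G : nat -> X)
  (alg : AWBGA D f t delta eta eps phi G)
  (eps0 : eps 0%N = 0)
  (h_delta_eps : forall m : nat, f - G m != 0 ->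
     delta m + eps m / `|f - G m| <= 4^-1)
  (h_delta_eta : forall m : nat, f - G m != 0 ->
     delta m + eta m.+1 <=
       2^-1 * Cqg q gamma `^ (- conj_exp q) * A `^ (- conj_exp q)
         * t m.+1 `^ conj_exp q * `|f - G m| `^ conj_exp q) :
  forall m : nat, (1 <= m)%N ->
    `|f - G m| <=
      Num.max (4 * e)
        (Cqg q gamma * (A + e)
           * (1 + \sum_(1 <= k < m.+1) t k `^ conj_exp q)
               `^ (- (conj_exp q)^-1)).
Proof.
move=> m _; have [D1 _ _] := D_dict; have [params [F algF]] := alg.
exact: (residual_bound gamma_gt0 q_gt1 X_modulus D1 A_gt0 f_fe fe_A1 params
  algF eps0 h_delta_eps h_delta_eta q_le2 m).
Qed.
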